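(* Consider the displacement group $\mathsf G$ in local coordinates $(\theta,x,y)=(x_1,x_2,x_3)\in\mathbb{R}^3$ with parameter $\beta\ge0$, $\beta\ne0$, and $$a^{\mathsf T}=\begin{pmatrix}1&0&0\\0&e^{\beta\theta}&1\end{pmatrix},\qquad z^{\mathsf T}=(0,0,-g(\theta,x,y)),$$ where $g$ is a smooth nowhere vanishing function, a potential $V\in C^\infty(\mathbb{R}^3)$ and $\rho^*=\frac1ce^{-V}$. Write $A_1f=\partial_\theta f$, $A_2f=e^{\beta\theta}\partial_xf+\partial_yf$, $\mathsf Zf=-g\,\partial_yf$ and $\mathsf U=(A_1f,A_2f,\mathsf Zf)^{\mathsf T}$. Then for every $f\in C^\infty(\mathsf G)$, $$\mathfrak R_{ab}^G(\nabla f,\nabla f)+\mathfrak R_{zb}(\nabla f,\nabla f)+\mathfrak R_{\rho^*}(\nabla f,\nabla f)=\mathsf U^{\mathsf T}\mathsf A\,\mathsf U,$$ where $\mathsf A$ is the symmetric $3\times3$ matrix function with entries $$\begin{aligned}\mathsf A_{11}&=\partial_\theta^2V-\beta^2\Big(1+\frac1{g^2}\Big),\\ \mathsf A_{22}&=\big[e^{2\beta\theta}\partial_x^2V+2e^{\beta\theta}\partial_x\partial_yV+\partial_y^2V\big]-\frac{\beta^2}{g^2}-\beta A_1V,\\ \mathsf A_{33}&=\frac{\beta^2}{2g^2}-\Gamma_1(\log g,\log g)-2\Gamma_1(\log\rho^*,\log g)-\Gamma_1(\log g,V)-\frac1g\big[\partial_\theta^2g+e^{2\beta\theta}\partial_x^2g+\partial_y^2g+2e^{\beta\theta}\partial_x\partial_yg\big],\\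 \mathsf A_{12}&=\mathsf A_{21}=\tfrac12\Big(\beta e^{\beta\theta}\partial_xV+2\big(e^{\beta\theta}\partial_\theta\partial_xV+\partial_\theta\partial_yV\big)+\beta A_2V\Big),\\ \mathsf A_{13}&=\mathsf A_{31}=\tfrac12\Big(\frac\beta g A_2V-g\,\partial_\theta\partial_yV\Big),\\ \mathsf A_{23}&=\mathsf A_{32}=-\tfrac12\Big(\frac\beta gA_1V-\frac{\beta^2}{g}\Big)-\tfrac12g\big(e^{\beta\theta}\partial_x\partial_yV+\partial_y^2V\big).\end{aligned}$$
   Context: General notation (here $n=2$, $m=1$). $a$ is a smooth $3\times2$ matrix function and $z$ a smooth $3\times1$ matrix function on $\mathbb{R}^3$. Write $\partial_p=\partial/\partial x_p$, $\alpha_{ip}=(a^{\mathsf T})_{ip}$, $\zeta_p=(z^{\mathsf T})_{1p}$; indices $i,k$ run over $\{1,2\}$ and $p,q,r,s$ over $\{1,2,3\}$; a derivative acts only on the factor immediately following it. $A_if=(a^{\mathsf T}\nabla)_if=\sum_p\alpha_{ip}\partial_pf$, $\mathsf Zf=(z^{\mathsf T}\nabla)_1f=\sum_p\zeta_p\partial_pf$, $\Gamma_1(f,h)=\sum_iA_if\,A_ih$. Derivatives of $\log g$ are understood as $\nabla\log g=\nabla g/g$. $\rho^*=\frac1c e^{-V}$ with $c=\int e^{-V}dx<\infty$. Matrices and vectors: pairs $(p,q)$ are ordered lexicographically. $Q\in\mathbb{R}^{4\times9}$ has entries $Q_{(i,k),(p,q)}=\alpha_{ip}\alpha_{kq}$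 (rows $(i,k)$ in lexicographic order). $P\in\mathbb{R}^{2\times9}$ has entries $P_{k,(p,q)}=\zeta_p\alpha_{kq}$. $D\in\mathbb{R}^4$: $D_{ik}=\sum_{p,r}\alpha_{ip}\,\partial_p\alpha_{kr}\,\partial_rf$. $E\in\mathbb{R}^2$: $E_i=\sum_{p,r}\alpha_{ip}\,\partial_p\zeta_r\,\partial_rf$. For the displacement group, $$\Lambda_1^{\mathsf T}=\Big(0,\beta\partial_xf,\tfrac{\beta\partial_yf}{2},\beta\partial_xf,0,0,\tfrac{\beta\partial_yf}{2},0,-\beta\partial_\theta f\Big),\qquad \Lambda_2^{\mathsf T}=(0,0,0,0,0,0,\lambda_6,0,\lambda_9),$$ $\lambda_6=\frac{\partial_\theta g\,\partial_yf}{g}-\frac{\beta A_2f}{g^2}-\frac{\partial_\theta g\,\partial_yf}{g}$, $\lambda_9=\frac{A_2g\,\partial_yf}{g}+\frac{\beta\partial_\theta f}{g^2}-\frac{A_2g\,\partial_yf}{g}$. Tensors: $\mathfrak R^G_{ab}(\nabla f,\nabla f)=\mathfrak R_{ab}(\nabla f,\nabla f)-\Lambda_1^{\mathsf T}Q^{\mathsf T}Q\Lambda_1-\Lambda_2^{\mathsf T}P^{\mathsf T}P\Lambda_2+D^{\mathsf T}D+E^{\mathsf T}E$. Let $b=-\frac12aa^{\mathsf T}\nabla V$. Then $$\mathfrak R_{ab}(\nabla f,\nabla f)=\sum_{i,k}\sum_{p,q,r}\big[\alpha_{ip}\partial_p\alpha_{iq}\,\partial_q\alpha_{kr}\,\partial_rf+\alpha_{ip}\alpha_{iq}(\partial_p\partial_q\alpha_{kr})\partial_rf-\alpha_{kr}\partial_r\alpha_{ip}\,\partial_p\alpha_{iq}\,\partial_qf-\alpha_{kr}\alpha_{ip}(\partial_r\partial_p\alpha_{iq})\partial_qf\big]A_kf-2\sum_i\sum_{q,r}\big(\alpha_{iq}\partial_qb_r\,\partial_rf-b_r\partial_r\alpha_{iq}\,\partial_qf\big)A_if,$$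 $$\mathfrak R_{zb}(\nabla f,\nabla f)=\sum_i\sum_{p,q,r}\big[\alpha_{ip}\partial_p\alpha_{iq}\,\partial_q\zeta_r\,\partial_rf+\alpha_{ip}\alpha_{iq}(\partial_p\partial_q\zeta_r)\partial_rf-\zeta_r\partial_r\alpha_{ip}\,\partial_p\alpha_{iq}\,\partial_qf-\zeta_r\alpha_{ip}(\partial_r\partial_p\alpha_{iq})\partial_qf\big]\mathsf Zf-2\sum_{q,r}\big(\zeta_q\partial_qb_r\,\partial_rf-b_r\partial_r\zeta_q\,\partial_qf\big)\mathsf Zf,$$ $$\begin{aligned}\mathfrak R_{\rho^*}(\nabla f,\nabla f)=&\ 2\sum_i\sum_{p,q,r,s}\big[(\partial_p\zeta_p)\zeta_q(\partial_q\alpha_{ir})\alpha_{is}+\zeta_p(\partial_p\zeta_q)(\partial_q\alpha_{ir})\alpha_{is}+\zeta_p\zeta_q(\partial_p\partial_q\alpha_{ir})\alpha_{is}+\zeta_p\zeta_q(\partial_q\alpha_{ir})(\partial_p\alpha_{is})\big]\partial_rf\,\partial_sf\\&+2\sum_i\sum_{q,r,s}(\mathsf Z\log\rho^* )\zeta_q(\partial_q\alpha_{ir})\alpha_{is}\,\partial_rf\,\partial_sf\\&-2\sum_i\sum_{p,q,r,s}\big[(\partial_p\alpha_{ip})\alpha_{iq}(\partial_q\zeta_r)\zeta_s+\alpha_{ip}(\partial_p\alpha_{iq})(\partial_q\zeta_r)\zeta_s+\alpha_{ip}\alpha_{iq}(\partial_p\partial_q\zeta_r)\zeta_s+\alpha_{ip}\alpha_{iq}(\partial_q\zeta_r)(\partial_p\zeta_s)\big]\partial_rf\,\partial_sf\\&-2\sum_i\sum_{q,r,s}(A_i\log\rho^*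 )\alpha_{iq}(\partial_q\zeta_r)\zeta_s\,\partial_rf\,\partial_sf.\end{aligned}$$ *)

(* Defs.v *)
From mathcomp Require Import all_boot all_order all_algebra mxtens.
From mathcomp Require Import all_classical all_reals all_analysis.

Set Implicit Arguments.
Unset Strict Implicit.
Unset Printing Implicit Defensive.

Import Order.TTheory GRing.Theory Num.Theory.
Import numFieldNormedType.Exports.
Local Open Scope ring_scope.

(* Coordinates (x_1, x_2, x_3) = (theta, x, y) are numbered 0, 1, 2. *)
Definition ith : 'I_3 := @Ordinal 3 0 isT.
Definition iex : 'I_3 := @Ordinal 3 1 isT.
Definition iey : 'I_3 := @Ordinal 3 2 isT.

Definition i1 : 'I_2 := @Ordinal 2 0 isT.
Definition i2 : 'I_2 := @Ordinal 2 1 isT.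

Section Calculus.
Variable R : realType.
Implicit Types (f : 'rV[R]_3 -> R) (p : 'I_3).

Definition pd p f : 'rV[R]_3 -> R := fun x => 'D_(delta_mx 0 p) f x.

(* C^infty: every iterated partial derivative exists and is continuous. *)
Definition smooth f : Prop :=
  forall s : seq 'I_3,
    continuous (foldr pd f s) /\
    forall p x, derivable (foldr pd f s) x (delta_mx 0 p).

Definition grad f (x : 'rV[R]_3) : 'cV[R]_3 := \col_p pd p f x.

(* The gradient of log g, read as (grad g) / g since g may be negative. *)
Definition grad_log f (x : 'rV[R]_3) : 'cV[R]_3 := (f x)^-1 *: grad f x.

End Calculus.

Section Density.
Variable R : realType.
Implicit Types V : 'rV[R]_3 -> R.

Definition leb := @lebesgue_measure R.

Definition row3 (t : R * R * R) : 'rV[R]_3 :=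
  \row_(p < 3) [:: t.1.1; t.1.2; t.2]`_p.

Definition norm_const V : \bar R :=
  (\int[((leb \x leb) \x leb)]_t (expR (- V (row3 t)))%:E)%E.

Definition rhostar V : 'rV[R]_3 -> R :=
  fun x => (fine (norm_const V))^-1 * expR (- V x).

Definition log_rhostar V : 'rV[R]_3 -> R := fun x => ln (rhostar V x).

End Density.

Section Tensors.
Variable R : realType.
Variables (a : 'rV[R]_3 -> 'M[R]_(3, 2)) (z : 'rV[R]_3 -> 'cV[R]_3).
Implicit Types (f g V : 'rV[R]_3 -> R) (x : 'rV[R]_3).

Definition alpha (i : 'I_2) (p : 'I_3) : 'rV[R]_3 -> R := fun x => (a x)^T i p.
Definition zeta (p : 'I_3) : 'rV[R]_3 -> R := fun x => (z x)^T 0 p.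

Definition Aop (i : 'I_2) f : 'rV[R]_3 -> R :=
  fun x => \sum_(p < 3) alpha i p x * pd p f x.
Definition Zop f : 'rV[R]_3 -> R :=
  fun x => \sum_(p < 3) zeta p x * pd p f x.

(* Gamma_1(f, h) at x as a bilinear form in the gradients u, v of f, h at x;
   this form also makes sense of Gamma_1(log g, h) through grad_log. *)
Definition Gamma1 x (u v : 'cV[R]_3) : R :=
  \sum_(i < 2) ((a x)^T *m u) i 0 * ((a x)^T *m v) i 0.

(* mxtens_unindex decodes the lexicographic numbering of pairs. *)
Definition Qmx x : 'M[R]_(2 * 2, 3 * 3) :=
  \matrix_(ik, pq)
    (alpha (mxtens_unindex ik).1 (mxtens_unindex pq).1 x
     * alpha (mxtens_unindex ik).2 (mxtens_unindex pq).2 x).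

Definition Pmx x : 'M[R]_(2, 3 * 3) :=
  \matrix_(k, pq)
    (zeta (mxtens_unindex pq).1 x * alpha k (mxtens_unindex pq).2 x).

Definition Dvec f x : 'cV[R]_(2 * 2) :=
  \col_ik \sum_(p < 3) \sum_(r < 3)
    alpha (mxtens_unindex ik).1 p x
    * pd p (alpha (mxtens_unindex ik).2 r) x * pd r f x.

Definition Evec f x : 'cV[R]_2 :=
  \col_i \sum_(p < 3) \sum_(r < 3)
    alpha i p x * pd p (zeta r) x * pd r f x.

Definition bdrift V (r : 'I_3) : 'rV[R]_3 -> R :=
  fun x => (- 2^-1 *: (a x *m (a x)^T *m grad V x)) r 0.

Definition Rab V f x : R :=
  (\sum_(i < 2) \sum_(k < 2)
    (\sum_(p < 3) \sum_(q < 3) \sum_(r < 3)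
      (alpha i p x * pd p (alpha i q) x * pd q (alpha k r) x * pd r f x
       + alpha i p x * alpha i q x * pd p (pd q (alpha k r)) x * pd r f x
       - alpha k r x * pd r (alpha i p) x * pd p (alpha i q) x * pd q f x
       - alpha k r x * alpha i p x * pd r (pd p (alpha i q)) x * pd q f x))
    * Aop k f x)
  - 2 * (\sum_(i < 2)
    (\sum_(q < 3) \sum_(r < 3)
      (alpha i q x * pd q (bdrift V r) x * pd r f x
       - bdrift V r x * pd r (alpha i q) x * pd q f x))
    * Aop i f x).

Definition Rzb V f x : R :=
  (\sum_(i < 2)
    (\sum_(p < 3) \sum_(q < 3) \sum_(r < 3)
      (alpha i p x * pd p (alpha i q) x * pd q (zeta r) x * pd r f x
       + alpha i p x * alpha i q x * pd p (pd q (zeta r)) x * pd r f x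
       - zeta r x * pd r (alpha i p) x * pd p (alpha i q) x * pd q f x
       - zeta r x * alpha i p x * pd r (pd p (alpha i q)) x * pd q f x))
    * Zop f x)
  - 2 * ((\sum_(q < 3) \sum_(r < 3)
      (zeta q x * pd q (bdrift V r) x * pd r f x
       - bdrift V r x * pd r (zeta q) x * pd q f x))
    * Zop f x).

Definition Rrho V f x : R :=
  2 * (\sum_(i < 2) \sum_(p < 3) \sum_(q < 3) \sum_(r < 3) \sum_(s < 3)
    (pd p (zeta p) x * zeta q x * pd q (alpha i r) x * alpha i s x
     + zeta p x * pd p (zeta q) x * pd q (alpha i r) x * alpha i s x
     + zeta p x * zeta q x * pd p (pd q (alpha i r)) x * alpha i s x
     + zeta p x * zeta q x * pd q (alpha i r) x * pd p (alpha i s) x)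
    * pd r f x * pd s f x)
  + 2 * (\sum_(i < 2) \sum_(q < 3) \sum_(r < 3) \sum_(s < 3)
    Zop (log_rhostar V) x * zeta q x * pd q (alpha i r) x * alpha i s x
    * pd r f x * pd s f x)
  - 2 * (\sum_(i < 2) \sum_(p < 3) \sum_(q < 3) \sum_(r < 3) \sum_(s < 3)
    (pd p (alpha i p) x * alpha i q x * pd q (zeta r) x * zeta s x
     + alpha i p x * pd p (alpha i q) x * pd q (zeta r) x * zeta s x
     + alpha i p x * alpha i q x * pd p (pd q (zeta r)) x * zeta s x
     + alpha i p x * alpha i q x * pd q (zeta r) x * pd p (zeta s) x)
    * pd r f x * pd s f x)
  - 2 * (\sum_(i < 2) \sum_(q < 3) \sum_(r < 3) \sum_(s < 3)
    Aop i (log_rhostar V) x * alpha i q x * pd q (zeta r) x * zeta s x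
    * pd r f x * pd s f x).

Definition RabG (L1 L2 : 'rV[R]_3 -> 'cV[R]_(3 * 3)) V f x : R :=
  Rab V f x
  - ((L1 x)^T *m (Qmx x)^T *m Qmx x *m L1 x) 0 0
  - ((L2 x)^T *m (Pmx x)^T *m Pmx x *m L2 x) 0 0
  + ((Dvec f x)^T *m Dvec f x) 0 0
  + ((Evec f x)^T *m Evec f x) 0 0.

End Tensors.

Section Displacement.
Variables (R : realType) (beta : R).
Implicit Types (f g V : 'rV[R]_3 -> R) (x : 'rV[R]_3).

Definition disp_aT x : 'M[R]_(2, 3) :=
  \matrix_(i < 2, p < 3)
    nth 0 (nth [::] [:: [:: 1; 0;                       0];
                        [:: 0; expR (beta * x 0 ith);   1]] i) p.

Definition disp_a x : 'M[R]_(3, 2) := (disp_aT x)^T.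

Definition disp_z g x : 'cV[R]_3 := (\row_(p < 3) [:: 0; 0; - g x]`_p)^T.

Definition Lambda1 f x : 'cV[R]_(3 * 3) :=
  \col_(j < 9)
    [:: 0; beta * pd iex f x; beta * pd iey f x / 2;
        beta * pd iex f x; 0; 0;
        beta * pd iey f x / 2; 0; - beta * pd ith f x]`_j.

Definition lambda6 g f x : R :=
  pd ith g x * pd iey f x / g x
  - beta * Aop disp_a i2 f x / g x ^+ 2
  - pd ith g x * pd iey f x / g x.

Definition lambda9 g f x : R :=
  Aop disp_a i2 g x * pd iey f x / g x
  + beta * pd ith f x / g x ^+ 2
  - Aop disp_a i2 g x * pd iey f x / g x.

(* The entries numbered 7 and 9; despite its name lambda_6 is the seventh. *)
Definition Lambda2 g f x : 'cV[R]_(3 * 3) :=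
  \col_(j < 9)
    [:: 0; 0; 0; 0; 0; 0; lambda6 g f x; 0; lambda9 g f x]`_j.

Definition Uvec g f x : 'cV[R]_3 :=
  \col_(j < 3)
    [:: Aop disp_a i1 f x; Aop disp_a i2 f x; Zop (disp_z g) f x]`_j.

Definition A11 g V x : R :=
  pd ith (pd ith V) x - beta ^+ 2 * (1 + 1 / g x ^+ 2).

Definition A22 g V x : R :=
  (expR (2 * beta * x 0 ith) * pd iex (pd iex V) x
   + 2 * expR (beta * x 0 ith) * pd iex (pd iey V) x
   + pd iey (pd iey V) x)
  - beta ^+ 2 / g x ^+ 2 - beta * Aop disp_a i1 V x.

Definition A33 g V x : R :=
  beta ^+ 2 / (2 * g x ^+ 2)
  - Gamma1 disp_a x (grad_log g x) (grad_log g x)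
  - 2 * Gamma1 disp_a x (grad (log_rhostar V) x) (grad_log g x)
  - Gamma1 disp_a x (grad_log g x) (grad V x)
  - 1 / g x * (pd ith (pd ith g) x
               + expR (2 * beta * x 0 ith) * pd iex (pd iex g) x
               + pd iey (pd iey g) x
               + 2 * expR (beta * x 0 ith) * pd iex (pd iey g) x).

Definition A12 V x : R :=
  1 / 2 * (beta * expR (beta * x 0 ith) * pd iex V x
           + 2 * (expR (beta * x 0 ith) * pd ith (pd iex V) x
                  + pd ith (pd iey V) x)
           + beta * Aop disp_a i2 V x).

Definition A13 g V x : R :=
  1 / 2 * (beta / g x * Aop disp_a i2 V x - g x * pd ith (pd iey V) x).

Definition A23 g V x : R :=
  - (1 / 2) * (beta / g x * Aop disp_a i1 V x - beta ^+ 2 / g x)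
  - 1 / 2 * g x * (expR (beta * x 0 ith) * pd iex (pd iey V) x
                   + pd iey (pd iey V) x).

Definition Amx g V x : 'M[R]_3 :=
  \matrix_(i < 3, j < 3)
    nth 0 (nth [::] [:: [:: A11 g V x; A12 V x;   A13 g V x];
                        [:: A12 V x;   A22 g V x; A23 g V x];
                        [:: A13 g V x; A23 g V x; A33 g V x]] i) j.

End Displacement.

(* Main.v *)
Require Import Defs.
From mathcomp Require Import all_boot all_order all_algebra.
From mathcomp Require Import all_classical all_reals all_analysis.
From mathcomp Require Import mxtens ring lra.
Import Order.TTheory GRing.Theory Num.Theory.
Import numFieldNormedType.Exports.
Local Open Scope ring_scope.

(* At a fixed point x both sides are rational functions of the values at x of
   e^{beta theta}, g, and the derivatives of g, V and f. Every derivative of the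
   entries of a, z and b is an explicit expression in these values, and
   grad log rho* = - grad V because c lies in (0, +oo), so that log c is a
   genuine constant. Substituting, and identifying mixed second derivatives of
   g and of V by Schwarz's theorem, leaves an identity of rational functions. *)

(** * Symmetry of mixed directional derivatives *)

Section Schwarz.
Local Open Scope classical_set_scope.
Context {R : realType} {E : normedModType R}.
Implicit Types (f : E -> R) (x u v : E).

(** The difference quotient of the restriction to the line is literally the one along [v], so no
    chain rule is involved. *)
Lemma is_derive_line f x v (t : R) : derivable f (t *: v + x) v ->
  is_derive t 1 (fun s : R => f (s *: v + x)) ('D_v f (t *: v + x)).
Proof.
have quot :
    (fun h : R => h^-1 *: (f ((h *: (1 : R^o) + t) *: v + x) - f (t *: v + x)))
  = (fun h : R => h^-1 *: (f (h *: v + (t *: v + x)) - f (t *: v + x))).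
  by apply/funext => h; rewrite (_ : h *: _ = h) ?[LHS]mulr1// scalerDl -addrA.
move=> df; split; first by rewrite /derivable /= quot.
by rewrite /derive /= quot.
Qed.

(** The mean value theorem is applied twice: along [u] to the difference of [f] between two parallel
    segments offset by [h *: v], then along [v] to ['D_u f]. *)
Lemma second_difference_MVT f x u v (h : R) : 0 < h ->
  (forall y, derivable f y u) -> (forall y, derivable ('D_u f) y v) ->
  exists s t : R, [/\ 0 < s < h, 0 < t < h &
    f (h *: u + (h *: v + x)) - f (h *: u + x) - (f (h *: v + x) - f x)
    = 'D_v ('D_u f) (t *: v + (s *: u + x)) * h * h].
Proof.
move=> h0 du dvu.
have diff_u y (s : R) := is_derive_line _ y _ s (du (s *: u + y)).
have diff_v y (t : R) := is_derive_line _ y _ t (dvu (t *: v + y)).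
have cts (g : R -> R) (dg : R -> R) : (forall s : R, is_derive s 1 g (dg s)) ->
    {within `[0, h], continuous g}.
  move=> dgP; apply: continuous_subspaceT => s.
  by apply: differentiable_continuous; apply/derivable1_diffP; have [] := dgP s.
have step1 (s : R) : is_derive s 1
    (fun s => f (s *: u + (h *: v + x)) - f (s *: u + x))
    ('D_u f (s *: u + (h *: v + x)) - 'D_u f (s *: u + x)).
  by apply: is_deriveB; exact: diff_u.
have [s sh eqs] := MVT h0 (fun s _ => step1 s) (cts _ _ step1).
have [t th eqt] := MVT h0 (fun t _ => diff_v (s *: u + x) t)
  (cts _ _ (diff_v (s *: u + x))).
exists s, t; split; first by move: sh; rewrite in_itv.
  by move: th; rewrite in_itv.
move: eqs eqt; rewrite !scale0r !add0r !subr0 => ->.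
by rewrite (addrCA (s *: u)) => ->.
Qed.

(* Both mixed derivatives are limits of the same symmetric second difference. *)
Lemma derive_comm f x u v :
  (forall y, derivable f y u) -> (forall y, derivable f y v) ->
  (forall y, derivable ('D_u f) y v) -> (forall y, derivable ('D_v f) y u) ->
  {for x, continuous ('D_v ('D_u f))} -> {for x, continuous ('D_u ('D_v f))} ->
  'D_v ('D_u f) x = 'D_u ('D_v f) x.
Proof.
move=> du dv dvu duv cvu cuv; apply/eqP; rewrite -subr_eq0 -normr_le0.
apply/ler_addgt0Pl => e e0; rewrite addr0.
(* The two hypotheses group the same second difference in two ways, which forces [c = d]; the
   triangle inequality through this common value then bounds [a - b]. *)
have concl (a b c d p q r w k : R) : 0 < k ->
    p - q - (r - w) = c * k * k -> p - r - (q - w) = d * k * k ->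
    `|a - c| < e / 2 -> `|b - d| < e / 2 -> `|a - b| <= e.
  move=> k0 eqc eqd ac bd.
  have cd : c = d.
    do 2 apply: (mulIf (lt0r_neq0 k0)); rewrite -eqc -eqd.
    by rewrite !opprB addrACA [RHS]addrACA (addrC (- q)).
  rewrite (le_trans (ler_distD c _ _))// [leRHS]splitr lerD ?(ltW ac)//.
  by rewrite cd distrC ltW.
have e2 : 0 < e / 2 by rewrite divr_gt0.
have [r1 /= r10 near1] := (nbhs_ballP _ _).1 ((cvgrPdist_lt _ _).1 cvu _ e2).
have [r2 /= r20 near2] := (nbhs_ballP _ _).1 ((cvgrPdist_lt _ _).1 cuv _ e2).
have bnd : 0 < `|u| + `|v| + 1 by rewrite ltr_wpDl// addr_ge0.
(* With this [h], the offset from [x] has norm at most h (|u| + |v|) < min(r1, r2), so every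
   intermediate point lies in both balls. The added 1 covers u = v = 0 and makes the bound
   strict. *)
pose h := Num.min r1 r2 / (`|u| + `|v| + 1).
have h0 : 0 < h by rewrite divr_gt0// lt_min r10.
have small (a b : R) w w' :
    0 < a < h -> 0 < b < h -> `|w| + `|w'| = `|u| + `|v| ->
    ball x r1 (a *: w + (b *: w' + x)) /\ ball x r2 (a *: w + (b *: w' + x)).
  move=> /andP[a0 ah] /andP[b0 bh] ww.
  rewrite -!ball_normE /ball_ /=; apply/andP; rewrite -lt_min.
  rewrite addrA opprD addrCA subrr addr0 normrN (le_lt_trans (ler_normD _ _))//.
  rewrite !normrZ !gtr0_norm//.
  have : a * `|w| + b * `|w'| <= h * (`|u| + `|v|).
    by rewrite -ww mulrDr lerD// ler_wpM2r// ltW.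
  move=> /le_lt_trans; apply; rewrite /h -mulrA gtr_pMr ?lt_min ?r10//.
  by rewrite mulrC ltr_pdivrMr// mul1r ltrDl.
have [s [t [sh th eq1]]] := second_difference_MVT f x u v h h0 du dvu.
have [s' [t' [sh' th' eq2]]] := second_difference_MVT f x v u h h0 dv duv.
have [/near1 /= nst _] := small _ _ _ _ th sh (addrC _ _).
have [_ /near2 /= nst'] := small _ _ _ _ th' sh' erefl.
(* The far corner x + h u + h v must have the same form in both second differences. *)
rewrite (addrCA (h *: v)) in eq2.
exact: (concl _ _ _ _ _ _ _ _ _ h0 eq1 eq2 nst nst').
Qed.

End Schwarz.

(** * Positivity of the normalizing constant and the logarithm of the density *)

Section NormalizingConstant.
Local Open Scope classical_set_scope.
Import HBNNSimple.

(* The integral of a nonnegative function is a supremum over the simple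
   functions below it; here the simple function is c * \1_A. *)
Lemma ge0_integral_gt0 {d} {T : measurableType d} {R : realType}
    (mu : {measure set T -> \bar R}) (f : T -> \bar R) (A : set T) (c : R) :
  measurable A -> (0 < mu A)%E -> 0 < c -> (forall t, 0 <= f t)%E ->
  (forall t, A t -> c%:E <= f t)%E -> (0 < \int[mu]_t f t)%E.
Proof.
move=> mA muA c0 f0 cf; rewrite ge0_integralTE//.
apply: (@lt_le_trans _ _ (c%:E * mu A)%E); first by rewrite mule_gt0.
apply: ereal_sup_ubound => /=.
exists (scale_nnsfun (indic_nnsfun R mA) (ltW c0)) => /= [t|].
  rewrite /measurable_realfun.mindic indicE.
  case: (boolP (t \in A)) => [|_]; last by rewrite mulr0.
  by rewrite inE mulr1 => /cf.
have -> : (c%:E * mu A = c%:E * sintegral mu (indic_nnsfun R mA))%E.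
  by rewrite sintegral_indic.
by rewrite -sintegralrM.
Qed.

(** By continuity, V < V(0) + 1 on a small cube around 0. There the integrand is at least e^{-V(0) -
    1}, and the cube has positive measure. *)
Lemma norm_const_gt0 {R : realType} (V : 'rV[R]_3 -> R) :
  {for 0, continuous V} -> (0 < norm_const V)%E.
Proof.
move=> cV.
have [r /= r0 Vr] := (nbhs_ballP _ _).1 ((cvgrPdist_lt _ _).1 cV 1 ltr01).
pose B : set (measurableTypeR R) := ball (0 : R) r.
have mB : measurable B by exact: measurable_realfun.measurable_ball.
have lB : (0 < @leb R B)%E.
  by rewrite /leb lebesgue_measure_ball ?ltW// lte_fin mulrn_wgt0.
rewrite /norm_const.
apply: (ge0_integral_gt0 _ _ (B `*` B `*` B) (expR (- V 0 - 1))).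
- by apply: measurableX => //; apply: measurableX.
- have : (0 < @leb R B * @leb R B * @leb R B)%E by rewrite !mule_gt0.
  have BB := product_measure1E (@leb R) (@leb R) mB mB.
  have BBB := product_measure1E (@leb R \x @leb R)%E (@leb R)
    (measurableX mB mB) mB.
  by rewrite -BB -BBB.
- exact: expR_gt0.
- by move=> t; rewrite lee_fin expR_ge0.
- move=> [[t1 t2] t3] /= [[/= B1 B2] B3]; rewrite lee_fin ler_expR.
  (* Balls of row vectors are defined entrywise, so a product of intervals maps into one. *)
  have /Vr : ball (0 : 'rV[R]_3) r (row3 (t1, t2, t3)).
    split=> // i [[|[|[|//]]] /= ilt]; rewrite !mxE //=.
  by rewrite ltr_norml => /andP[]; lra.
Qed.

Lemma log_rhostarE {R : realType} (V : 'rV[R]_3 -> R) :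
  {for 0, continuous V} -> (norm_const V < +oo)%E ->
  log_rhostar V = fun x => - ln (fine (norm_const V)) - V x.
Proof.
move=> cV Vint; apply/funext => x; have V0 := norm_const_gt0 V cV.
(* Since [fine] sends [+oo] to 0, finiteness of the integral matters here as much as its positivity;
   with both, [ln] splits the product. *)
have c0 : 0 < fine (norm_const V) by rewrite fine_gt0// V0.
by rewrite /log_rhostar /rhostar lnM ?posrE ?invr_gt0 ?expR_gt0// expRK lnV.
Qed.

End NormalizingConstant.

(** * Sums over small index sets and over pairs, and Gram forms *)

Lemma sum_ord2 {U : nmodType} (F : 'I_2 -> U) : \sum_(i < 2) F i = F i1 + F i2.
Proof. by rewrite big_ord_recl big_ord1; congr (F _ + F _); apply: val_inj. Qed.

Lemma sum_ord3 {U : nmodType} (F : 'I_3 -> U) :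
  \sum_(p < 3) F p = F ith + F iex + F iey.
Proof.
rewrite 2!big_ord_recl big_ord1 addrA.
by congr (F _ + F _ + F _); apply: val_inj.
Qed.

Lemma sum_mxtens {U : nmodType} m n (F : 'I_(m * n) -> U) :
  \sum_(k < m * n) F k =
  \sum_(i < m) \sum_(j < n) F (mxtens_index (i, j)).
Proof.
rewrite pair_bigA /= (reindex (@mxtens_index m n)) /=.
  by apply: eq_bigr => -[].
exists (@mxtens_unindex m n) => k _.
- exact: mxtens_indexK.
- exact: mxtens_unindexK.
Qed.

Lemma mulmx_tr_self {R : pzRingType} m (w : 'cV[R]_m) :
  (w^T *m w) 0 0 = \sum_(i < m) w i 0 * w i 0.
Proof. by rewrite mxE; apply: eq_bigr => i _; rewrite mxE. Qed.

Lemma mulmx_gram {R : comPzRingType} m n (A : 'M[R]_(m, n)) (u : 'cV[R]_n) :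
  (u^T *m A^T *m A *m u) 0 0 = \sum_(i < m) (A *m u) i 0 * (A *m u) i 0.
Proof. by rewrite -mulmx_tr_self trmx_mul !mulmxA. Qed.

(** * Calculus of partial derivatives *)

Section PartialDerivatives.
Context {R : realType}.
Implicit Types (f g h : 'rV[R]_3 -> R) (p q : 'I_3) (x : 'rV[R]_3).

Definition pderivable h := forall x p, derivable h x (delta_mx 0 p).

Lemma pd_is_derive h p x d : is_derive x (delta_mx 0 p) h d -> pd p h x = d.
Proof. by move=> hd; rewrite /pd derive_val. Qed.

Lemma smooth_pderivable f : smooth f -> pderivable f.
Proof. by move=> sf x p; have [_] := sf [::]; apply. Qed.

Lemma smooth_continuous f : smooth f -> continuous f.
Proof. by move=> sf; have [] := sf [::]. Qed.

(** [foldr] applies the last index first, so differentiating [pd p f] along [s] is differentiating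
    [f] along [rcons s p]. *)
Lemma smooth_pd f p : smooth f -> smooth (pd p f).
Proof. by move=> sf s; have := sf (rcons s p); rewrite foldr_rcons. Qed.

Lemma pd_comm f p q : smooth f -> pd p (pd q f) = pd q (pd p f).
Proof.
move=> sf; apply/funext => x; apply: derive_comm.
- by move=> y; exact: smooth_pderivable.
- by move=> y; exact: smooth_pderivable.
- by move=> y; apply: (smooth_pderivable (pd q f)); exact: smooth_pd.
- by move=> y; apply: (smooth_pderivable (pd p f)); exact: smooth_pd.
- exact: (smooth_continuous (pd p (pd q f)) (smooth_pd _ p (smooth_pd _ q sf))).
- exact: (smooth_continuous (pd q (pd p f)) (smooth_pd _ q (smooth_pd _ p sf))).
Qed.

Lemma pderivable_cst (c : R) : pderivable (fun=> c).
Proof. by move=> x p; exact: derivable_cst. Qed.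

Lemma pderivableN h : pderivable h -> pderivable (fun y => - h y).
Proof. by move=> dh x p; exact: derivableN. Qed.

Lemma pderivableD g h :
  pderivable g -> pderivable h -> pderivable (fun y => g y + h y).
Proof. by move=> dg dh x p; exact: derivableD. Qed.

Lemma pderivableM g h :
  pderivable g -> pderivable h -> pderivable (fun y => g y * h y).
Proof. by move=> dg dh x p; exact: derivableM. Qed.

(** This rule and the next ones are equalities of functions, so that they rewrite under binders and
    inside a further derivative. *)
Lemma pd_cst p (c : R) : pd p (fun=> c) = fun=> 0.
Proof. by apply/funext => x; exact: derive_cst. Qed.

Lemma pdN p h : pderivable h -> pd p (fun y => - h y) = fun y => - pd p h y.
Proof. by move=> dh; apply/funext => x; exact: deriveN. Qed.

Lemma pdD p g h : pderivable g -> pderivable h ->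
  pd p (fun y => g y + h y) = fun y => pd p g y + pd p h y.
Proof. by move=> dg dh; apply/funext => x; exact: deriveD. Qed.

Lemma pdM p g h : pderivable g -> pderivable h ->
  pd p (fun y => g y * h y) = fun y => g y * pd p h y + h y * pd p g y.
Proof. by move=> dg dh; apply/funext => x; exact: deriveM. Qed.

Lemma pdZ p (c : R) h : pderivable h ->
  pd p (fun y => c * h y) = fun y => c * pd p h y.
Proof. by move=> dh; apply/funext => x; exact: deriveZ. Qed.

End PartialDerivatives.

(** * Derivatives of the exponential coefficient *)

Section ExpTheta.
Context {R : realType} (beta : R).

Definition exp_th (x : 'rV[R]_3) : R := expR (beta * x 0 ith).

(** On the line through [x] in direction [p] the function is [expR] after the affine map [lin],
    whose slope is beta or 0. The one-variable chain rule gives the derivative there, and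
    [derivable1P] and [is_derive_line] at parameter 0 carry it back. *)
Lemma is_derive_exp_th p x : is_derive x (delta_mx 0 p) exp_th
  (exp_th x * (beta * (p == ith)%:R)).
Proof.
pose k : R := beta * (p == ith)%:R.
pose lin : R -> R := k *: (id : R -> R) + cst (beta * x 0 ith).
have linE h : lin h = k * h + beta * x 0 ith by [].
have lineE : (fun h : R => exp_th (h *: delta_mx 0 p + x)) = expR \o lin.
  apply/funext => h; rewrite /= linE /exp_th !mxE /= eq_sym /k; congr expR.
  by ring.
have dlin : is_derive (0 : R) 1 lin k.
  by apply: is_derive_eq; rewrite addr0 [LHS]mulr1.
have dline : is_derive (0 : R) 1 (expR \o lin) (exp_th x * k).
  by apply: is_derive1_comp; rewrite linE mulr0 add0r; exact: is_derive_expR.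
have [dx dE] := dline.
have dx' : derivable exp_th x (delta_mx 0 p).
  by apply/derivable1P; rewrite lineE.
have dx0 : derivable exp_th ((0 : R) *: delta_mx 0 p + x) (delta_mx 0 p).
  by rewrite scale0r add0r.
have [_] := is_derive_line _ _ _ _ dx0; rewrite lineE scale0r add0r dE => dxE.
by split.
Qed.

Lemma pderivable_exp_th : pderivable exp_th.
Proof. by move=> x p; have [] := is_derive_exp_th p x. Qed.

Lemma pd_exp_th p : pd p exp_th = fun x => exp_th x * (beta * (p == ith)%:R).
Proof. by apply/funext => x; apply: pd_is_derive; exact: is_derive_exp_th. Qed.

End ExpTheta.

(** * The pointwise identity as algebra in finitely many values *)

(* The left-hand side as a function of the values at one point, with the
   summation operators S2 over 'I_2 and S3 over 'I_3 as parameters: replacing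
   them by explicit two- and three-term sums expands all nested sums at once. *)
Section JetForms.
Context {R : realType}.
Variables (S2 : ('I_2 -> R) -> R) (S3 : ('I_3 -> R) -> R).
(** Derivative indices come first: [dal p i q] stands for the p-th derivative of alpha_{iq}, and
    likewise for the others. [F] and [l] stand for the gradients of f and log rho*, and [L1], [L2]
    for the two Lambda vectors indexed by pairs. *)
Variables (al : 'I_2 -> 'I_3 -> R) (dal : 'I_3 -> 'I_2 -> 'I_3 -> R).
Variables (ddal : 'I_3 -> 'I_3 -> 'I_2 -> 'I_3 -> R).
Variables (ze : 'I_3 -> R) (dze : 'I_3 -> 'I_3 -> R).
Variables (ddze : 'I_3 -> 'I_3 -> 'I_3 -> R).
Variables (b : 'I_3 -> R) (db : 'I_3 -> 'I_3 -> R).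
Variables (L1 L2 : 'I_3 -> 'I_3 -> R) (l F : 'I_3 -> R).

Definition jetA (i : 'I_2) (u : 'I_3 -> R) : R := S3 (fun p => al i p * u p).

Definition jetZ (u : 'I_3 -> R) : R := S3 (fun p => ze p * u p).

Definition jet_ab : R :=
  S2 (fun i => S2 (fun k =>
    S3 (fun p => S3 (fun q => S3 (fun r =>
      al i p * dal p i q * dal q k r * F r
      + al i p * al i q * ddal p q k r * F r
      - al k r * dal r i p * dal p i q * F q
      - al k r * al i p * ddal r p i q * F q)))
    * jetA k F))
  - 2 * S2 (fun i =>
    S3 (fun q => S3 (fun r => al i q * db q r * F r - b r * dal r i q * F q))
    * jetA i F).

Definition jet_zb : R :=
  S2 (fun i =>
    S3 (fun p => S3 (fun q => S3 (fun r =>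
      al i p * dal p i q * dze q r * F r
      + al i p * al i q * ddze p q r * F r
      - ze r * dal r i p * dal p i q * F q
      - ze r * al i p * ddal r p i q * F q)))
    * jetZ F)
  - 2 * (S3 (fun q => S3 (fun r => ze q * db q r * F r - b r * dze r q * F q))
         * jetZ F).

Definition jet_rho : R :=
  2 * S2 (fun i => S3 (fun p => S3 (fun q => S3 (fun r => S3 (fun s =>
    (dze p p * ze q * dal q i r * al i s
     + ze p * dze p q * dal q i r * al i s
     + ze p * ze q * ddal p q i r * al i s
     + ze p * ze q * dal q i r * dal p i s)
    * F r * F s)))))
  + 2 * S2 (fun i => S3 (fun q => S3 (fun r => S3 (fun s =>
    jetZ l * ze q * dal q i r * al i s * F r * F s))))
  - 2 * S2 (fun i => S3 (fun p => S3 (fun q => S3 (fun r => S3 (fun s =>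
    (dal p i p * al i q * dze q r * ze s
     + al i p * dal p i q * dze q r * ze s
     + al i p * al i q * ddze p q r * ze s
     + al i p * al i q * dze q r * dze p s)
    * F r * F s)))))
  - 2 * S2 (fun i => S3 (fun q => S3 (fun r => S3 (fun s =>
    jetA i l * al i q * dze q r * ze s * F r * F s)))).

(** The quadratic forms built from Q, P, D and E enter as sums of squares, the shape produced by
    [gram_Q], [gram_P], [gram_D] and [gram_E]. *)
Definition jet_abG : R :=
  jet_ab
  - S2 (fun i => S2 (fun k =>
      S3 (fun p => S3 (fun q => al i p * al k q * L1 p q)) ^+ 2))
  - S2 (fun k => S3 (fun p => S3 (fun q => ze p * al k q * L2 p q)) ^+ 2)
  + S2 (fun i => S2 (fun k =>
      S3 (fun p => S3 (fun r => al i p * dal p k r * F r)) ^+ 2))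
  + S2 (fun i => S3 (fun p => S3 (fun r => al i p * dze p r * F r)) ^+ 2).

Definition jet_total : R := jet_abG + jet_zb + jet_rho.

End JetForms.

Definition sum2 {R : realType} (u : 'I_2 -> R) : R := u i1 + u i2.

Definition sum3 {R : realType} (u : 'I_3 -> R) : R := u ith + u iex + u iey.

(* E stands for e^{beta theta}, and F, g1, V1, g2, V2 for the first and second
   derivatives of f, g, V; each tab_* tabulates the argument of the same name
   of jet_total for the displacement group. *)
Section JetIdentity.
Context {R : realType}.
Variables (beta E g : R) (g1 V1 F : 'I_3 -> R) (g2 V2 : 'I_3 -> 'I_3 -> R).

Definition tab_al (i : 'I_2) (p : 'I_3) : R :=
  match nat_of_ord i, nat_of_ord p with
  | 0%N, 0%N => 1 | 1%N, 1%N => E | 1%N, 2%N => 1 | _, _ => 0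
  end.

Definition tab_dal (p : 'I_3) (i : 'I_2) (q : 'I_3) : R :=
  match nat_of_ord p, nat_of_ord i, nat_of_ord q with
  | 0%N, 1%N, 1%N => beta * E | _, _, _ => 0
  end.

Definition tab_ddal (p q : 'I_3) (i : 'I_2) (r : 'I_3) : R :=
  match nat_of_ord p, nat_of_ord q, nat_of_ord i, nat_of_ord r with
  | 0%N, 0%N, 1%N, 1%N => beta ^+ 2 * E | _, _, _, _ => 0
  end.

Definition tab_ze (p : 'I_3) : R :=
  match nat_of_ord p with 2%N => - g | _ => 0 end.

Definition tab_dze (p q : 'I_3) : R :=
  match nat_of_ord q with 2%N => - g1 p | _ => 0 end.

Definition tab_ddze (p q r : 'I_3) : R :=
  match nat_of_ord r with 2%N => - g2 p q | _ => 0 end.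

(** The rows of a a^T are (1, 0, 0), (0, E^2, E) and (0, E, 1), so the last two entries are
    multiples of A_2 V. *)
Definition tab_b (r : 'I_3) : R :=
  match nat_of_ord r with
  | 0%N => - 2^-1 * V1 ith
  | 1%N => - 2^-1 * (E * (E * V1 iex + V1 iey))
  | _ => - 2^-1 * (E * V1 iex + V1 iey)
  end.

(** The gradient of e^{beta theta}, for the product rule in [tab_db]. *)
Definition tab_dE (p : 'I_3) : R :=
  match nat_of_ord p with 0%N => beta * E | _ => 0 end.

Definition tab_db (p r : 'I_3) : R :=
  match nat_of_ord r with
  | 0%N => - 2^-1 * V2 p ith
  | 1%N => - 2^-1 * (E * (E * V2 p iex + tab_dE p * V1 iex + V2 p iey)
                     + tab_dE p * (E * V1 iex + V1 iey))
  | _ => - 2^-1 * (E * V2 p iex + tab_dE p * V1 iex + V2 p iey)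
  end.

Definition tab_L1 (p q : 'I_3) : R :=
  match nat_of_ord p, nat_of_ord q with
  | 0%N, 1%N => beta * F iex
  | 0%N, 2%N => beta * F iey / 2
  | 1%N, 0%N => beta * F iex
  | 2%N, 0%N => beta * F iey / 2
  | 2%N, 2%N => - beta * F ith
  | _, _ => 0
  end.

(** The cancelling terms of [lambda6] and [lambda9] are kept, so that the table agrees with
    [Lambda2] by computation once A_2 is expanded. *)
Definition tab_L2 (p q : 'I_3) : R :=
  match nat_of_ord p, nat_of_ord q with
  | 2%N, 0%N => g1 ith * F iey / g - beta * (E * F iex + F iey) / g ^+ 2
                - g1 ith * F iey / g
  | 2%N, 2%N => (E * g1 iex + g1 iey) * F iey / g + beta * F ith / g ^+ 2
                - (E * g1 iex + g1 iey) * F iey / g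
  | _, _ => 0
  end.

(** The matrix entries enter through equations, so that each can be matched separately with its
    definition. Their right-hand sides have grad log g as [g^-1 * g1] and grad log rho* as
    [- V1]. *)
Lemma jet_identity (a11 a22 a33 a12 a13 a23 : R) (g0 : g != 0)
    (V2C : forall p q, V2 p q = V2 q p) (g2C : forall p q, g2 p q = g2 q p) :
  a11 = V2 ith ith - beta ^+ 2 * (1 + 1 / g ^+ 2) ->
  a22 = (E ^+ 2 * V2 iex iex + 2 * E * V2 iex iey + V2 iey iey)
        - beta ^+ 2 / g ^+ 2 - beta * V1 ith ->
  a33 = beta ^+ 2 / (2 * g ^+ 2)
        - (g^-1 * g1 ith * (g^-1 * g1 ith)
           + (E * (g^-1 * g1 iex) + g^-1 * g1 iey)
             * (E * (g^-1 * g1 iex) + g^-1 * g1 iey))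
        - 2 * (- V1 ith * (g^-1 * g1 ith)
               + (E * - V1 iex + - V1 iey)
                 * (E * (g^-1 * g1 iex) + g^-1 * g1 iey))
        - (g^-1 * g1 ith * V1 ith
           + (E * (g^-1 * g1 iex) + g^-1 * g1 iey) * (E * V1 iex + V1 iey))
        - 1 / g * (g2 ith ith + E ^+ 2 * g2 iex iex + g2 iey iey
                   + 2 * E * g2 iex iey) ->
  a12 = 1 / 2 * (beta * E * V1 iex + 2 * (E * V2 ith iex + V2 ith iey)
                 + beta * (E * V1 iex + V1 iey)) ->
  a13 = 1 / 2 * (beta / g * (E * V1 iex + V1 iey) - g * V2 ith iey) ->
  a23 = - (1 / 2) * (beta / g * V1 ith - beta ^+ 2 / g)
        - 1 / 2 * g * (E * V2 iex iey + V2 iey iey) ->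
  jet_total sum2 sum3 tab_al tab_dal tab_ddal tab_ze tab_dze tab_ddze tab_b
    tab_db tab_L1 tab_L2 (fun p => - V1 p) F
  = (let u1 := F ith in let u2 := E * F iex + F iey in let u3 := - g * F iey in
     (u1 * a11 + u2 * a12 + u3 * a13) * u1
     + (u1 * a12 + u2 * a22 + u3 * a23) * u2
     + (u1 * a13 + u2 * a23 + u3 * a33) * u3).
Proof.
move=> -> -> -> -> -> ->.
have Vxt := V2C iex ith; have Vyt := V2C iey ith; have Vyx := V2C iey iex.
have gxt := g2C iex ith; have gyt := g2C iey ith; have gyx := g2C iey iex.
(* Unfolding the indices to numerals lets every table lookup reduce; folding them back afterwards
   leaves uniform atoms, on which the symmetry equations give each mixed derivative one form. *)
cbv beta iota zeta delta [jet_total jet_abG jet_ab jet_zb jet_rho jetA jetZ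
  sum2 sum3 tab_al tab_dal tab_ddal tab_ze tab_dze tab_ddze tab_b tab_db tab_dE
  tab_L1 tab_L2 nat_of_ord ith iex iey i1 i2].
rewrite -/ith -/iex -/iey Vxt Vyt Vyx gxt gyt gyx.
field.
by rewrite g0.
Qed.

End JetIdentity.

(** * Values and derivatives of a, z and b for the displacement group *)

(** Case analysis that ends in the named indices, on which the tables compute and which later
    rewrites recognize. *)
Lemma ord2_cases (P : 'I_2 -> Prop) : P i1 -> P i2 -> forall i, P i.
Proof.
move=> P1 P2 [[|[|//]] ilt].
- by rewrite (_ : Ordinal _ = i1)//; exact: val_inj.
- by rewrite (_ : Ordinal _ = i2)//; exact: val_inj.
Qed.

Lemma ord3_cases (P : 'I_3 -> Prop) : P ith -> P iex -> P iey -> forall p, P p.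
Proof.
move=> P0 P1 P2 [[|[|[|//]]] plt].
- by rewrite (_ : Ordinal _ = ith)//; exact: val_inj.
- by rewrite (_ : Ordinal _ = iex)//; exact: val_inj.
- by rewrite (_ : Ordinal _ = iey)//; exact: val_inj.
Qed.

Section DisplacementJets.
Context {R : realType} (beta : R) (g V : 'rV[R]_3 -> R).
Hypothesis g_smooth : smooth g.
Hypothesis V_smooth : smooth V.
Implicit Types (f : 'rV[R]_3 -> R) (x : 'rV[R]_3).

Local Notation E := (exp_th beta).
Local Notation al := (alpha (disp_a beta)).
Local Notation ze := (zeta (disp_z g)).

Lemma alpha_disp i p : al i p = fun x => tab_al (E x) i p.
Proof.
apply/funext => x; rewrite /alpha !mxE.
by elim/ord2_cases: i; elim/ord3_cases: p.
Qed.

Lemma pd_alpha_disp p i q : pd p (al i q) = fun x => tab_dal beta (E x) p i q.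
Proof.
rewrite alpha_disp; elim/ord2_cases: i; elim/ord3_cases: q;
  rewrite /tab_al /tab_dal /= ?pd_cst; elim/ord3_cases: p => //=;
  rewrite pd_exp_th; apply/funext => x; rewrite ?mulr0 ?mulr1//.
all: by rewrite mulrC.
Qed.

Lemma pd_pd_alpha_disp p q i r :
  pd p (pd q (al i r)) = fun x => tab_ddal beta (E x) p q i r.
Proof.
rewrite pd_alpha_disp; elim/ord2_cases: i; elim/ord3_cases: r;
  rewrite /tab_dal /tab_ddal /=; elim/ord3_cases: q => //=; rewrite ?pd_cst;
  elim/ord3_cases: p => //=;
  rewrite (pdZ _ _ _ (pderivable_exp_th beta)) pd_exp_th;
  apply/funext => x; move: (E x) => e /=; ring.
Qed.

Lemma zeta_disp p : ze p = fun x => tab_ze (g x) p.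
Proof. by apply/funext => x; rewrite /zeta !mxE; elim/ord3_cases: p. Qed.

Lemma pd_zeta_disp p q : pd p (ze q) = fun x => tab_dze (fun p => pd p g x) p q.
Proof.
rewrite zeta_disp.
elim/ord3_cases: q; rewrite /tab_ze /tab_dze /= ?pd_cst//.
by rewrite pdN//; exact: smooth_pderivable.
Qed.

Lemma pd_pd_zeta_disp p q r :
  pd p (pd q (ze r)) = fun x => tab_ddze (fun p q => pd p (pd q g) x) p q r.
Proof.
rewrite pd_zeta_disp.
elim/ord3_cases: r; rewrite /tab_dze /tab_ddze /= ?pd_cst//.
by rewrite pdN//; apply: smooth_pderivable; exact: smooth_pd.
Qed.

Lemma bdrift_disp r :
  bdrift (disp_a beta) V r = fun x => tab_b (E x) (fun p => pd p V x) r.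
Proof.
apply/funext => x; rewrite /bdrift !mxE sum_ord3 !mxE !sum_ord2 !mxE.
elim/ord3_cases: r; rewrite /tab_b /= -/(E x);
  move: (E x) (pd ith V x) (pd iex V x) (pd iey V x) => e v0 v1 v2; ring.
Qed.

Lemma pd_bdrift_disp p r : pd p (bdrift (disp_a beta) V r) =
  fun x => tab_db beta (E x) (fun p => pd p V x)
    (fun p q => pd p (pd q V) x) p r.
Proof.
have dV q : pderivable (pd q V) := smooth_pderivable _ (smooth_pd _ q V_smooth).
have dE : pderivable E := pderivable_exp_th beta.
have pdE x : pd p E x = tab_dE beta (E x) p.
  rewrite pd_exp_th; elim/ord3_cases: p; rewrite /tab_dE /= ?mulr0 ?mulr1//.
  by rewrite mulrC.
(* The common factor E V_x + V_y = A_2 V of the second and third entries of b. *)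
have dS := pderivableD _ _ (pderivableM _ _ dE (dV iex)) (dV iey).
have pdS := pdD p _ _ (pderivableM _ _ dE (dV iex)) (dV iey).
rewrite bdrift_disp; elim/ord3_cases: r; rewrite /tab_b /tab_db /=.
- exact: (pdZ p _ _ (dV ith)).
- rewrite (pdZ p _ _ (pderivableM _ _ dE dS)) (pdM p _ _ dE dS).
  rewrite pdS (pdM p _ _ dE (dV iex)); apply/funext => x.
  by rewrite pdE (mulrC (pd iex V x)) (mulrC (_ + _) (tab_dE _ _ _)).
- rewrite (pdZ p _ _ dS) pdS (pdM p _ _ dE (dV iex)); apply/funext => x.
  by rewrite pdE (mulrC (pd iex V x)).
Qed.

End DisplacementJets.

(** * The curvature tensors in terms of values at one point *)

(** The form is the squared norm of Q u; summing rows and columns over pairs cancels the decoding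
    [mxtens_unindex] in the entries of Q. *)
Lemma gram_Q {R : realType} (a : 'rV[R]_3 -> 'M[R]_(3, 2)) x
    (u : 'cV[R]_(3 * 3)) :
  (u^T *m (Qmx a x)^T *m Qmx a x *m u) 0 0 =
  \sum_(i < 2) \sum_(k < 2)
    (\sum_(p < 3) \sum_(q < 3)
      alpha a i p x * alpha a k q x * u (mxtens_index (p, q)) 0) ^+ 2.
Proof.
rewrite mulmx_gram sum_mxtens; apply: eq_bigr => i _; apply: eq_bigr => k _.
rewrite -expr2 mxE sum_mxtens; congr (_ ^+ 2).
by do 2 (apply: eq_bigr => ? _); rewrite mxE !mxtens_indexK.
Qed.

Lemma gram_P {R : realType} (a : 'rV[R]_3 -> 'M[R]_(3, 2)) z x
    (u : 'cV[R]_(3 * 3)) :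
  (u^T *m (Pmx a z x)^T *m Pmx a z x *m u) 0 0 =
  \sum_(k < 2)
    (\sum_(p < 3) \sum_(q < 3)
      zeta z p x * alpha a k q x * u (mxtens_index (p, q)) 0) ^+ 2.
Proof.
rewrite mulmx_gram; apply: eq_bigr => k _.
rewrite -expr2 mxE sum_mxtens; congr (_ ^+ 2).
by do 2 (apply: eq_bigr => ? _); rewrite mxE !mxtens_indexK.
Qed.

Lemma gram_D {R : realType} (a : 'rV[R]_3 -> 'M[R]_(3, 2)) f x :
  ((Dvec a f x)^T *m Dvec a f x) 0 0 =
  \sum_(i < 2) \sum_(k < 2)
    (\sum_(p < 3) \sum_(r < 3)
      alpha a i p x * pd p (alpha a k r) x * pd r f x) ^+ 2.
Proof.
rewrite mulmx_tr_self sum_mxtens; apply: eq_bigr => i _; apply: eq_bigr => k _.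
by rewrite -expr2 mxE !mxtens_indexK.
Qed.

Lemma gram_E {R : realType} (a : 'rV[R]_3 -> 'M[R]_(3, 2)) z f x :
  ((Evec a z f x)^T *m Evec a z f x) 0 0 =
  \sum_(i < 2)
    (\sum_(p < 3) \sum_(r < 3)
      alpha a i p x * pd p (zeta z r) x * pd r f x) ^+ 2.
Proof. by rewrite mulmx_tr_self; apply: eq_bigr => i _; rewrite -expr2 mxE. Qed.

Lemma curvature_jet {R : realType} (a : 'rV[R]_3 -> 'M[R]_(3, 2))
    (z : 'rV[R]_3 -> 'cV[R]_3) (L1 L2 : 'rV[R]_3 -> 'cV[R]_(3 * 3))
    (V f : 'rV[R]_3 -> R) x :
  RabG a z L1 L2 V f x + Rzb a z V f x + Rrho a z V f x =
  jet_total sum2 sum3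
    (fun i p => alpha a i p x) (fun p i q => pd p (alpha a i q) x)
    (fun p q i r => pd p (pd q (alpha a i r)) x)
    (fun p => zeta z p x) (fun p q => pd p (zeta z q) x)
    (fun p q r => pd p (pd q (zeta z r)) x)
    (fun r => bdrift a V r x) (fun p r => pd p (bdrift a V r) x)
    (fun p q => L1 x (mxtens_index (p, q)) 0)
    (fun p q => L2 x (mxtens_index (p, q)) 0)
    (fun p => pd p (log_rhostar V) x) (fun p => pd p f x).
Proof.
(* Putting the big sums back in place of [sum2] and [sum3] makes both sides agree by unfolding, once
   the Gram forms are rewritten. *)
have <- : (fun u => \sum_(i < 2) u i) = @sum2 R.
  by apply/funext => u; rewrite sum_ord2.
have <- : (fun u => \sum_(p < 3) u p) = @sum3 R.
  by apply/funext => u; rewrite sum_ord3.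
by rewrite /RabG gram_Q gram_P gram_D gram_E.
Qed.

(** * Operators and vectors of the displacement group at a point, and the conclusion *)

Lemma pd_log_rhostar {R : realType} (V : 'rV[R]_3 -> R) p :
  smooth V -> (norm_const V < +oo)%E ->
  pd p (log_rhostar V) = fun x => - pd p V x.
Proof.
move=> sV Vint; have cV := smooth_continuous V sV 0.
have dV := smooth_pderivable V sV.
rewrite log_rhostarE//.
rewrite (pdD p _ _ (pderivable_cst _) (pderivableN _ dV)) (pdN p V dV) pd_cst.
by apply/funext => x; rewrite add0r.
Qed.

Lemma Aop1_disp {R : realType} (beta : R) h x :
  Aop (disp_a beta) i1 h x = pd ith h x.
Proof.
by rewrite /Aop sum_ord3 !alpha_disp /tab_al /= mul1r !mul0r !addr0.
Qed.

Lemma Aop2_disp {R : realType} (beta : R) h x :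
  Aop (disp_a beta) i2 h x = exp_th beta x * pd iex h x + pd iey h x.
Proof.
by rewrite /Aop sum_ord3 !alpha_disp /tab_al /= mul1r mul0r add0r.
Qed.

Lemma Zop_disp {R : realType} (g h : 'rV[R]_3 -> R) x :
  Zop (disp_z g) h x = - g x * pd iey h x.
Proof.
by rewrite /Zop sum_ord3 !zeta_disp /tab_ze /= !mul0r !add0r.
Qed.

Lemma Gamma1_disp {R : realType} (beta : R) x (u v : 'cV[R]_3) :
  Gamma1 (disp_a beta) x u v = u ith 0 * v ith 0 +
    (exp_th beta x * u iex 0 + u iey 0) * (exp_th beta x * v iex 0 + v iey 0).
Proof.
rewrite /Gamma1 sum_ord2 !mxE !sum_ord3 !mxE /= -/(exp_th beta x).
by rewrite !mul1r !mul0r !addr0 !add0r.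
Qed.

Lemma exp_th_sqr {R : realType} (beta : R) (x : 'rV[R]_3) :
  expR (2 * beta * x 0 ith) = exp_th beta x ^+ 2.
Proof. by rewrite /exp_th -expRM_natl mulrA. Qed.

(** For concrete indices the pair (p, q) sits at position 3p + q, counted from 0, so each of the
    nine cases holds by computation. *)
Lemma Lambda1_disp {R : realType} (beta : R) f x p q :
  Lambda1 beta f x (mxtens_index (p, q)) 0 =
  tab_L1 beta (fun p => pd p f x) p q.
Proof. by rewrite mxE; elim/ord3_cases: p; elim/ord3_cases: q. Qed.

Lemma Lambda2_disp {R : realType} (beta : R) g f x p q :
  Lambda2 beta g f x (mxtens_index (p, q)) 0 =
  tab_L2 beta (exp_th beta x) (g x) (fun p => pd p g x) (fun p => pd p f x) p q.
Proof.
rewrite mxE /lambda6 /lambda9 !Aop2_disp.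
by elim/ord3_cases: p; elim/ord3_cases: q.
Qed.

Theorem corollary4p4 (R : realType) (beta : R) (g V : 'rV[R]_3 -> R)
    (beta_ge0 : 0 <= beta) (beta_neq0 : beta != 0)
    (g_smooth : smooth g) (g_neq0 : forall x, g x != 0)
    (V_smooth : smooth V) (V_int : (norm_const V < +oo)%E) :
  forall f : 'rV[R]_3 -> R, smooth f ->
  forall x : 'rV[R]_3,
    RabG (disp_a beta) (disp_z g) (Lambda1 beta f) (Lambda2 beta g f) V f x
    + Rzb (disp_a beta) (disp_z g) V f x
    + Rrho (disp_a beta) (disp_z g) V f x
    = ((Uvec beta g f x)^T *m Amx beta g V x *m Uvec beta g f x) 0 0.
Proof.
move=> f f_smooth x.
have funext2 T (h k : 'I_3 -> 'I_3 -> T) : (forall p q, h p q = k p q) -> h = k.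
  by move=> hk; apply/funext => p; apply/funext => q.
rewrite curvature_jet.
(* Each argument of [jet_total] is now replaced, as a function of its indices, by its table. *)
have -> : (fun i p => alpha (disp_a beta) i p x) = tab_al (exp_th beta x).
  by apply/funext => i; apply/funext => p; rewrite alpha_disp.
have -> : (fun p i q => pd p (alpha (disp_a beta) i q) x)
    = tab_dal beta (exp_th beta x).
  apply/funext => p; apply/funext => i; apply/funext => q.
  by rewrite pd_alpha_disp.
have -> : (fun p q i r => pd p (pd q (alpha (disp_a beta) i r)) x)
    = tab_ddal beta (exp_th beta x).
  apply: funext2 => p q; apply/funext => i; apply/funext => r.
  by rewrite pd_pd_alpha_disp.
have -> : (fun p => zeta (disp_z g) p x) = tab_ze (g x).
  by apply/funext => p; rewrite zeta_disp.
have -> : (fun p q => pd p (zeta (disp_z g) q) x)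
    = tab_dze (fun p => pd p g x).
  by apply: funext2 => p q; rewrite pd_zeta_disp.
have -> : (fun p q r => pd p (pd q (zeta (disp_z g) r)) x)
    = tab_ddze (fun p q => pd p (pd q g) x).
  by apply: funext2 => p q; apply/funext => r; rewrite pd_pd_zeta_disp.
have -> : (fun r => bdrift (disp_a beta) V r x)
    = tab_b (exp_th beta x) (fun p => pd p V x).
  by apply/funext => r; rewrite bdrift_disp.
have -> : (fun p r => pd p (bdrift (disp_a beta) V r) x)
    = tab_db beta (exp_th beta x) (fun p => pd p V x)
        (fun p q => pd p (pd q V) x).
  by apply: funext2 => p r; rewrite pd_bdrift_disp.
rewrite (funext2 _ _ _ (Lambda1_disp beta f x)).
rewrite (funext2 _ _ _ (Lambda2_disp beta g f x)).
have -> : (fun p => pd p (log_rhostar V) x) = (fun p => - pd p V x).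
  by apply/funext => p; rewrite pd_log_rhostar.
have VC p q : pd p (pd q V) x = pd q (pd p V) x.
  by rewrite (pd_comm _ _ _ V_smooth).
have gC p q : pd p (pd q g) x = pd q (pd p g) x.
  by rewrite (pd_comm _ _ _ g_smooth).
have key := jet_identity beta (exp_th beta x) (g x) (fun p => pd p g x)
  (fun p => pd p V x) (fun p => pd p f x) (fun p q => pd p (pd q g) x)
  (fun p q => pd p (pd q V) x) (A11 beta g V x) (A22 beta g V x)
  (A33 beta g V x) (A12 beta V x) (A13 beta g V x) (A23 beta g V x)
  (g_neq0 x) VC gC.
(* What remains is the expansion of U^T A U, followed by the six equations for the entries of A. *)
rewrite key {key}.
- by rewrite mxE sum_ord3 !mxE !sum_ord3 !mxE /= Aop1_disp Aop2_disp Zop_disp.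
- by [].
- by rewrite /A22 Aop1_disp exp_th_sqr.
- by rewrite /A33 !Gamma1_disp exp_th_sqr !mxE !pd_log_rhostar.
- by rewrite /A12 Aop2_disp.
- by rewrite /A13 Aop2_disp.
- by rewrite /A23 Aop1_disp.
Qed.
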